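(* Let $x$ be a real number with $0.6666666667\le x<1$, and let $P$ be the Borel probability measure on $\mathbb{R}$ with $P(\{j\})=p_j$ for every $j\in\mathbb{N}=\{1,2,3,\dots\}$, where $p_j=(1-x)^{j-1}x$. Then for every $n\in\mathbb{N}$ the set $$\alpha_n=\{1,2,3,\dots,n-1,Av[n,\infty)\}$$ is the optimal set of $n$-means for $P$.
   Context: For a Borel probability measure $P$ on $\mathbb{R}$ and a nonempty finite set $\alpha\subset\mathbb{R}$, the distortion error is $V(P;\alpha)=\int\min_{a\in\alpha}|y-a|^2\,dP(y)$. A set $\alpha\subset\mathbb{R}$ with $1\le\mathrm{card}(\alpha)\le n$ is called an optimal set of $n$-means for $P$ if $V(P;\alpha)=\inf\{V(P;\beta):\beta\subset\mathbb{R},\ 1\le\mathrm{card}(\beta)\le n\}$. For a random variable $X$ with distribution $P$ and $k\in\mathbb{N}$, $Av[k,\infty)=E(X\mid X\in\{k,k+1,\dots\})=\dfrac{\sum_{j\ge k}j\,p_j}{\sum_{j\ge k}p_j}$. For $n=1$ the set $\alpha_1$ is $\{Av[1,\infty)\}$. *)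

(* Defs.v *)
From HB Require Import structures.
From mathcomp Require Import all_boot all_order all_algebra finmap.
From mathcomp Require Import all_classical all_reals all_analysis.

Set Implicit Arguments.
Unset Strict Implicit.
Unset Printing Implicit Defensive.

Import Order.TTheory GRing.Theory Num.Theory.
Import numFieldNormedType.Exports.

Local Open Scope ring_scope.

(* The neutral element +oo makes the iterated minimum over alpha the true
   minimum whenever alpha is nonempty. *)
Definition sqdist (R : realType) (alpha : {fset R}) (y : R) : \bar R :=
  \big[Order.min/+oo%E]_(a <- alpha) (`|y - a| ^+ 2)%:E.

Definition distortion (R : realType) (P : probability (measurableTypeR R) R)
    (alpha : {fset R}) : \bar R :=
  (\int[P]_y sqdist alpha y)%E.

Definition optimal_set (R : realType) (P : probability (measurableTypeR R) R)
    (n : nat) (alpha : {fset R}) : Prop :=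
  (1 <= #|` alpha| <= n)%N /\
  distortion P alpha =
    ereal_inf [set distortion P beta
              | beta in [set beta : {fset R} | (1 <= #|` beta| <= n)%N]]%classic.

Definition mass (R : realType) (P : probability (measurableTypeR R) R)
    (j : nat) : \bar R :=
  P [set (j%:R : R)]%classic.

(* E(X | X \in {k, k+1, ...}) for X of law P carried by the positive integers:
   both series are taken in the extended reals, where they always converge
   since their terms are nonnegative. *)
Definition Av (R : realType) (P : probability (measurableTypeR R) R)
    (k : nat) : R :=
  fine (\sum_(k <= j <oo) ((j%:R)%:E * mass P j))%E /
  fine (\sum_(k <= j <oo) mass P j)%E.

(* {1, 2, ..., n - 1, Av[n, oo)}, for n >= 1 *)
Definition means_set (R : realType) (P : probability (measurableTypeR R) R)
    (n : nat) : {fset R} :=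
  ([fset (j%:R : R) | j in iota 1 n.-1] `|` [fset Av P n])%fset.

(* Main.v *)
Require Import Defs.
From HB Require Import structures.
From mathcomp Require Import all_boot all_order all_algebra finmap.
From mathcomp Require Import all_classical all_reals all_analysis.
From mathcomp Require Import measurable_realfun.
From mathcomp Require Import ring lra.

(* Put q = 1 - x < 1/3 and G(m, B) = \sum_j q^j d(m + j, B)^2, so that the
   distortion is x G(1, B) and G(m, B) = d(m, B)^2 + q G(m + 1, B).
   By induction on n, for all m at once, every B with at most n + 1 points has
   G(m, B) >= q^(n+1) / (1 - q)^3, with equality only for
   B = {m, ..., m + n - 1, m + n + q / (1 - q)}. For the step, let b be the
   least point of B. Once an integer is not nearest to b, no later one is, so b
   can be dropped from then on and the induction hypothesis applies to B \ b.
   If b serves only m, this gives the bound, with equality iff b = m. The other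
   cases are strict: b serves nothing, exactly m and m + 1, or m, m + 1 and
   m + 2 at least. The hypothesis q < 1/3 is sharp when b serves exactly m and
   m + 1. *)

Set Implicit Arguments.
Unset Strict Implicit.
Unset Printing Implicit Defensive.

Import Order.TTheory GRing.Theory Num.Theory.
Import numFieldNormedType.Exports.

Local Open Scope ring_scope.

(** * Geometric series by telescoping *)

(** The partial sums telescope to [g 0 - q ^+ N * g N], and the remainder dies because [2 * q < 1].
    Each closed form below comes from exhibiting [g], whose value at [j] is the tail sum from [j] on
    divided by [q ^+ j]. *)
Lemma telescoping_geometric_series (R : realType) (q K : R) (g t : nat -> R) :
    0 <= q -> q < 2^-1 -> (forall j, 0 <= t j) ->
    (forall j, t j = g j - q * g j.+1) -> (forall j, `|g j| <= K * 2 ^+ j) ->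
  (\sum_(0 <= j <oo) (q ^+ j * t j)%:E)%E = (g 0%N)%:E.
Proof.
move=> q0 q2 t0 tE gK; apply: cvg_lim => //.
have sumE N : (\sum_(0 <= j < N) (q ^+ j * t j)%:E)%E = (g 0%N - q ^+ N * g N)%:E.
  rewrite sumEFin; congr EFin; elim: N => [|N IH].
    by rewrite big_geq// expr0 mul1r subrr.
  by rewrite big_nat_recr//= IH tE exprS; ring.
rewrite (_ : (fun N : nat => _) = fun N => (g 0%N - q ^+ N * g N)%:E); last first.
  by apply/funext => N; rewrite -sumE.
apply: cvg_EFin; first by near=> N.
suff : ((fun N => g 0%N - q ^+ N * g N) @ \oo --> g 0%N - 0)%classic by rewrite subr0.
apply: cvgB; first exact: cvg_cst.
have gK0 : (geometric K (2 * q) @ \oo --> (0 : R))%classic.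
  by apply: cvg_geometric; rewrite ger0_norm; lra.
apply/norm_cvg0P; apply: (squeeze_cvgr _ (cvg_cst _) gK0).
near=> N; rewrite normr_ge0 normrM normrX (ger0_norm q0) /geometric /= exprMn.
rewrite mulrA mulrC ler_wpM2r ?exprn_ge0//.
Unshelve. all: by end_near. Qed.

(** * Squared distance to a finite set *)

Lemma sqdist_ge0 (R : realType) (B : {fset R}) y : (0 <= sqdist B y)%E.
Proof. by apply: le_bigmin => [|a _]; rewrite ?leey// lee_fin exprn_ge0. Qed.

Lemma sqdist_le (R : realType) (B : {fset R}) y a :
  a \in B -> (sqdist B y <= ((y - a) ^+ 2)%:E)%E.
Proof.
move=> aB; rewrite /sqdist (big_rem a)//= ge_min real_normK ?num_real//.
by rewrite lexx.
Qed.

Lemma sqdist_attained (R : realType) (B : {fset R}) y : B != fset0 ->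
  exists2 a, a \in B & sqdist B y = ((y - a) ^+ 2)%:E.
Proof.
move=> /fset0Pn[a0 a0B].
case: (@arg_minP _ _ B [` a0B]%fset xpredT (fun a => `|y - val a|) erefl).
move=> -[a aB] _ /= amin; exists a => //.
apply/le_anti; rewrite sqdist_le//=.
rewrite /sqdist big_seq; apply: le_bigmin => [|c cB]; first by rewrite leey.
rewrite lee_fin -(real_normK (num_real (y - a))).
by apply: lerXn2r; rewrite ?nnegrE//; exact: (amin [` cB]%fset isT).
Qed.

Lemma sqdist_fset1 (R : realType) (a y : R) :
  sqdist [fset a]%fset y = ((y - a) ^+ 2)%:E.
Proof.
have [|b] := @sqdist_attained R [fset a]%fset y.
  by apply/fset0Pn; exists a; rewrite inE.
by rewrite inE => /eqP ->.
Qed.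

Lemma sqdist_antimono (R : realType) (B B' : {fset R}) y :
  (B' `<=` B)%fset -> (sqdist B y <= sqdist B' y)%E.
Proof.
move=> /fsubsetP B'B; have [->|/(@sqdist_attained _ _ y)[a aB' ->]] := eqVneq B' fset0.
  (* The minimum over the empty set is [+oo]. *)
  by rewrite /sqdist [leRHS]big_nil leey.
exact/sqdist_le/B'B.
Qed.

Lemma sqdist_nearest (R : realType) (B : {fset R}) y b :
    b \in B -> (forall c, c \in B -> `|y - b| <= `|y - c|) ->
  sqdist B y = ((y - b) ^+ 2)%:E.
Proof.
move=> bB bmin; apply/le_anti; rewrite sqdist_le//=.
have [|a aB ->] := @sqdist_attained _ B y; first by apply/fset0Pn; exists b.
rewrite lee_fin -(real_normK (num_real (y - b))) -(real_normK (num_real (y - a))).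
by apply: lerXn2r; rewrite ?nnegrE//; exact: bmin.
Qed.

Lemma fset_min (R : realType) (B : {fset R}) : B != fset0 ->
  exists2 b, b \in B & forall c, c \in B -> b <= c.
Proof.
move=> /fset0Pn[a0 a0B].
case: (@arg_minP _ _ B [` a0B]%fset xpredT val erefl).
move=> -[a aB] _ /= amin; exists a => // c cB.
exact: (amin [` cB]%fset isT).
Qed.

Lemma measurable_sqdist (R : realType) (B : {fset R}) :
  measurable_fun setT (sqdist B : measurableTypeR R -> \bar R).
Proof.
rewrite /sqdist; elim: (enum_fset B) => [|a s IH].
  by under eq_fun do rewrite big_nil; exact: measurable_cst.
under eq_fun do rewrite big_cons.
apply: measurable_mine => //; apply/measurable_EFinP.
apply: measurable_funX; apply: measurableT_comp; first exact: normr_measurable.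
by apply: measurable_funB => //; exact: measurable_cst.
Qed.

(** * The geometrically weighted error *)

(** Supplies growth bounds for telescoping. With the additive constant 2, the induction step is
    exactly [(e + j%:R - 1) ^+ 2 >= 0]. *)
Lemma sqr_le_exp2 (R : realDomainType) (e : R) j :
  (e + j%:R) ^+ 2 + 2 <= (e ^+ 2 + 2) * 2 ^+ j.
Proof.
elim: j => [|j IH]; first by rewrite addr0 mulr1.
have : 0 <= (e + j%:R - 1) ^+ 2 by exact: sqr_ge0.
have -> : (e ^+ 2 + 2) * 2 ^+ j.+1 = 2 * ((e ^+ 2 + 2) * 2 ^+ j).
  by rewrite (exprS 2 j); ring.
rewrite -natr1; nra.
Qed.

Definition geo_error (R : realType) (q : R) (m : nat) (B : {fset R}) : \bar R :=
  (\sum_(0 <= j <oo) ((q ^+ j)%:E * sqdist B (m + j)%:R))%E.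

Lemma geo_error_recl (R : realType) (q : R) m B : 0 <= q ->
  geo_error q m B = (sqdist B m%:R + q%:E * geo_error q m.+1 B)%E.
Proof.
move=> q0; have term_ge0 k j : (0 <= (q ^+ j)%:E * sqdist B (k + j)%:R)%E.
  by rewrite mule_ge0 ?sqdist_ge0// lee_fin exprn_ge0.
rewrite /geo_error nneseries_recl// expr0 mul1e addn0; congr (_ + _)%E.
rewrite -nneseriesZl// -(@nneseries_addn _ (fun j => (q ^+ j)%:E * _)%E)//.
apply: eq_eseriesr => j _.
by rewrite addn1 muleA -EFinM exprS addSnnS.
Qed.

Lemma le_geo_error (R : realType) (q : R) m (B B' : {fset R}) : 0 <= q ->
    (forall y, m%:R <= y -> (sqdist B' y <= sqdist B y)%E) ->
  (geo_error q m B' <= geo_error q m B)%E.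
Proof.
move=> q0 leB; apply: lee_nneseries => j _.
  by rewrite mule_ge0 ?sqdist_ge0// lee_fin exprn_ge0.
by apply: lee_wpmul2l; rewrite ?lee_fin ?exprn_ge0// leB// ler_nat leq_addr.
Qed.

(** Mean-variance decomposition: the weights [q ^+ j] at [m + j] have total mass [1 / (1 - q)], mean
    [m + q / (1 - q)] and variance [q / (1 - q) ^+ 2]. *)
Lemma geo_error_fset1 (R : realType) (q a : R) m : 0 < q < 3^-1 ->
  geo_error q m [fset a]%fset =
  ((a - m%:R - q / (1 - q)) ^+ 2 / (1 - q) + q / (1 - q) ^+ 3)%:E.
Proof.
move=> /andP[q0 q3]; have q1 : 0 < 1 - q by lra.
(* [e + j%:R] is the mean of the weights starting at [m + j], minus [a]; so [g j] is the claimed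
   value with [m + j] in place of [m]. *)
pose e : R := m%:R - a + q / (1 - q).
pose g (j : nat) := (e + j%:R) ^+ 2 / (1 - q) + q / (1 - q) ^+ 3.
have c0 : 0 <= q / (1 - q) ^+ 3 by rewrite divr_ge0 ?exprn_ge0 ?ltW.
have g0 j : 0 <= g j by rewrite addr_ge0// divr_ge0 ?sqr_ge0 ?ltW.
rewrite /geo_error (eq_eseriesr (g := fun j => (q ^+ j * ((m + j)%:R - a) ^+ 2)%:E)); last first.
  by move=> j _; rewrite sqdist_fset1 EFinM.
rewrite (@telescoping_geometric_series _ q ((e ^+ 2 + 2) / (1 - q) + q / (1 - q) ^+ 3) g).
- by congr EFin; rewrite /g /e addr0; field; lra.
- exact: ltW.
- lra.
- by move=> j; exact: sqr_ge0.
- by move=> j; rewrite /g /e natrD -natr1; field; lra.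
- move=> j; rewrite ger0_norm// mulrDl lerD//.
    rewrite [leRHS]mulrAC ler_pM2r ?invr_gt0//; have := @sqr_le_exp2 _ e j; lra.
  by rewrite ler_peMr// exprn_ege1// ler1n.
Qed.

(** Since [b <= c], a point closer to [c] than to [b] lies beyond their midpoint, and so does every
    later [z]; hence [c] can replace [b] there. *)
Lemma sqdist_fsetD1_min (R : realType) (B : {fset R}) b c y z :
    (forall a, a \in B -> b <= a) -> c \in B -> `|y - c| < `|y - b| -> y <= z ->
  (sqdist (B `\ b)%fset z <= sqdist B z)%E.
Proof.
move=> bmin cB ycb yz.
have : (y - c) ^+ 2 < (y - b) ^+ 2.
  rewrite -(real_normK (num_real (y - c))) -(real_normK (num_real (y - b))).
  by rewrite ltrXn2r.
have bc := bmin _ cB => cby.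
have cDb : c \in (B `\ b)%fset.
  by rewrite !inE cB andbT; apply/eqP => cb; rewrite cb ltxx in ycb.
have [|a aB ->] := @sqdist_attained _ B z; first by apply/fset0Pn; exists c.
have [->|ab] := eqVneq a b; last by apply: sqdist_le; rewrite !inE ab.
apply: le_trans (sqdist_le _ cDb) _; rewrite lee_fin; nra.
Qed.

(** * The candidate set of means *)

(** The last point is the mean of the weights carried by the integers from [m + n] on; [n] counts
    only the integer points. *)
Definition geo_means (R : realType) (q : R) (m n : nat) : {fset R} :=
  ([fset (j%:R : R) | j in iota m n] `|` [fset ((m + n)%:R + q / (1 - q))%R])%fset.

Lemma geo_meansS (R : realType) (q : R) m n :
  geo_means q m n.+1 = (m%:R |` geo_means q m.+1 n)%fset.
Proof.
apply/fsetP => a; rewrite !inE addSnnS orbA; congr (_ || _).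
apply/imfsetP/orP => /= [[j]|[/eqP->|/imfsetP[j/= jm ->]]].
- rewrite inE => /orP[/eqP-> ->|jm ->]; first by left.
  by right; apply/imfsetP; exists j.
- by exists m => //; rewrite inE eqxx.
- by exists j => //; rewrite inE jm orbT.
Qed.

(** * Numerical inequalities for q below 1/3 *)

(** Here [u] stands for [m - b] and [p] for [q ^+ n]. Once the common term is cancelled, the left
    side is at most [q ^+ 2 / (1 - q) ^+ 2], while the minimum over [u] on the right is
    [q / (1 + q)], reached at [u = - q / (1 + q)]. Comparing them amounts to [3 * q < 1]. *)
Lemma two_point_bound (R : realFieldType) (q p u : R) :
    0 < q < 3^-1 -> 0 <= p <= 1 ->
  q / (1 - q) ^+ 3 * (q * p) <
  u ^+ 2 + q * ((u + 1) ^+ 2 + q * (q / (1 - q) ^+ 3 * p)).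
Proof.
move=> /andP[q0 q3] /andP[p0 p1]; have q1 : 0 < 1 - q by lra.
have -> : q / (1 - q) ^+ 3 * (q * p) =
    q ^+ 2 * p / (1 - q) ^+ 2 + q * (q * (q / (1 - q) ^+ 3 * p)) by field; lra.
rewrite mulrDr addrA ltrD2r.
have sq : 0 <= ((1 + q) * u + q) ^+ 2 by exact: sqr_ge0.
apply: (@lt_le_trans _ _ (q / (1 + q))); last first.
  by rewrite ler_pdivrMr; nra.
apply: (@le_lt_trans _ _ (q ^+ 2 / (1 - q) ^+ 2)).
  by rewrite ler_pM2r ?invr_gt0 ?exprn_gt0// ger_pMr// exprn_gt0.
rewrite ltr_pdivrMr ?exprn_gt0// mulrAC ltr_pdivlMr; nra.
Qed.

(** Completing the square in [u], with [W] the total weight of three consecutive integers, gives the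
    minimum [q * (1 + 4 * q + q ^+ 2) / W] on the right; the left side is largest at [p = 1]. *)
Lemma three_point_bound (R : realFieldType) (q p u : R) :
    0 < q < 3^-1 -> 0 <= p <= 1 ->
  q / (1 - q) ^+ 3 * (q * p) <
  u ^+ 2 + q * ((u + 1) ^+ 2 + q * (u + 2) ^+ 2).
Proof.
move=> /andP[q0 q3] /andP[p0 p1]; have q1 : 0 < 1 - q by lra.
pose W := 1 + q + q ^+ 2.
have W0 : 0 < W by rewrite /W; nra.
have sq : 0 <= (W * u + (q + 2 * q ^+ 2)) ^+ 2 by exact: sqr_ge0.
apply: (@lt_le_trans _ _ (q * (1 + 4 * q + q ^+ 2) / W)); last first.
  rewrite ler_pdivrMr// -subr_ge0; move: sq; congr (_ <= _); rewrite /W; ring.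
apply: (@le_lt_trans _ _ (q ^+ 2 / (1 - q) ^+ 3)).
  have -> : q / (1 - q) ^+ 3 * (q * p) = q ^+ 2 * p / (1 - q) ^+ 3 by field; lra.
  by rewrite ler_pM2r ?invr_gt0 ?exprn_gt0// ger_pMr// exprn_gt0.
rewrite ltr_pdivrMr ?exprn_gt0// mulrAC ltr_pdivlMr//.
rewrite expr2 -!mulrA ltr_pM2l//.
(* The factor [(1 - q) ^+ 3] is replaced by its value at [q = 1 / 3], which leaves enough room and
   lowers the degree. *)
have cube : 8 / 27 <= (1 - q) ^+ 3.
  have -> : 8 / 27 = (2 / 3) ^+ 3 :> R by field.
  by apply: lerXn2r; rewrite ?nnegrE; lra.
apply: (@lt_le_trans _ _ ((1 + 4 * q + q ^+ 2) * (8 / 27))); last first.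
  by rewrite ler_pM2l//; nra.
rewrite /W; nra.
Qed.

(** * Upper and lower bounds for the error *)

Lemma geo_means0 (R : realType) (q : R) m :
  geo_means q m 0 = [fset (m%:R + q / (1 - q))%R]%fset.
Proof.
apply/fsetP => a; rewrite !inE addn0; case: imfsetP => // -[j].
by rewrite in_nil.
Qed.

Lemma card_geo_means (R : realType) (q : R) m n :
  (1 <= #|` geo_means q m n| <= n.+1)%N.
Proof.
elim: n m => [|n IH] m; first by rewrite geo_means0 cardfs1.
have /andP[lb ub] := IH m.+1.
by rewrite geo_meansS cardfsU1 ltn_addl//= -[n.+2]add1n leq_add// leq_b1.
Qed.

(** The point [m] costs nothing at [m], and adding it can only lower the error from [m.+1] on. The
    lower bound below turns this inequality into an equality. *)
Lemma geo_error_means_le (R : realType) (q : R) m n : 0 < q < 3^-1 ->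
  (geo_error q m (geo_means q m n) <= (q / (1 - q) ^+ 3 * q ^+ n)%:E)%E.
Proof.
move=> q03; have /andP[q0 q3] := q03; elim: n m => [|n IH] m.
  rewrite geo_means0 geo_error_fset1// lee_fin expr0 mulr1.
  by rewrite (_ : _ - _ - _ = 0) ?expr0n/= ?mul0r ?add0r//; ring.
rewrite geo_error_recl ?(ltW q0)// geo_meansS.
have -> : (q / (1 - q) ^+ 3 * q ^+ n.+1)%:E =
    (0 + q%:E * (q / (1 - q) ^+ 3 * q ^+ n)%:E)%E.
  by rewrite add0e -EFinM (exprS q n); congr EFin; ring.
apply: leeD.
  by apply: le_trans (sqdist_le _ (fset1U1 _ _)) _; rewrite subrr expr0n.
apply: lee_wpmul2l; first by rewrite lee_fin ltW.
apply: le_trans (IH m.+1); apply: le_geo_error => [|y _]; first exact: ltW.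
exact/sqdist_antimono/fsubsetU1.
Qed.

Lemma geo_error_lower_bound (R : realType) (q : R) n m (B : {fset R}) :
    0 < q < 3^-1 -> (1 <= #|` B| <= n.+1)%N ->
  ((q / (1 - q) ^+ 3 * q ^+ n)%:E <= geo_error q m B)%E /\
  (geo_error q m B = (q / (1 - q) ^+ 3 * q ^+ n)%:E -> B = geo_means q m n).
Proof.
move=> q03; have /andP[q0 q3] := q03; have q1 : 0 < 1 - q by lra.
have q_ge0 := ltW q0.
set C := q / (1 - q) ^+ 3.
have C0 : 0 < C by rewrite divr_gt0 ?exprn_gt0.
(* Serves the three strict cases, where the uniqueness claim is vacuous. *)
have ltP c (e : \bar R) Q : (c%:E < e)%E -> (c%:E <= e)%E /\ (e = c%:E -> Q).
  by move=> ce; split=> [|eE]; [exact: ltW|rewrite eE ltxx in ce].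
elim: n m B => [|n IH] m B cardB.
  have /cardfs1P[a ->] : #|` B| == 1%N by rewrite eqn_leq andbC.
  rewrite geo_error_fset1// expr0 mulr1 geo_means0 -/C; split.
    by rewrite lee_fin lerDr divr_ge0 ?sqr_ge0 ?ltW.
  move=> [] /eqP; rewrite -subr_eq0 addrK mulf_eq0 invr_eq0 (gt_eqF q1) orbF.
  by rewrite sqrf_eq0 subr_eq0 subr_eq addrC => /eqP ->; rewrite addrC.
have p01 : 0 <= q ^+ n <= 1 by rewrite exprn_ge0// exprn_ile1//; lra.
have qS : q ^+ n.+1 = q * q ^+ n by rewrite exprS.
have step k v r : sqdist B k%:R = v%:E -> (r%:E <= geo_error q k.+1 B)%E ->
    ((v + q * r)%:E <= geo_error q k B)%E.
  move=> vE rG; rewrite geo_error_recl// vE EFinD EFinM leeD2l//.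
  by apply: lee_wpmul2l; rewrite ?lee_fin.
have /andP[cardB0 cardBn] := cardB.
have [|b bB bmin] := @fset_min _ B; first by rewrite -cardfs_gt0.
have drop k c : c \in B -> `|k%:R - c| < `|k%:R - b| ->
    ((C * q ^+ n)%:E <= geo_error q k (B `\ b)%fset <= geo_error q k B)%E /\
    (geo_error q k (B `\ b)%fset = (C * q ^+ n)%:E -> B `\ b = geo_means q k n)%fset.
  move=> cB cb.
  have cB' : c \in (B `\ b)%fset.
    by rewrite !inE cB andbT; apply: contraTneq cb => ->; rewrite ltxx.
  have [|-> meansE] := IH k (B `\ b)%fset.
    rewrite cardfs_gt0; apply/andP; split; first by apply/fset0Pn; exists c.
    by move: cardBn; rewrite (cardfsD1 b) bB.
  split=> //=; apply: le_geo_error => // y ky; exact: sqdist_fsetD1_min bmin cB cb ky.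
have nearest (k : nat) : (exists2 c, c \in B & `|k%:R - c| < `|k%:R - b|) \/
    sqdist B k%:R = ((k%:R - b) ^+ 2)%:E.
  have [|nP] := pselect (exists2 c, c \in B & `|k%:R - c| < `|k%:R - b|).
    by left.
  right; apply: sqdist_nearest => // c cB; rewrite leNgt; apply/negP => lt_c.
  by apply: nP; exists c.
(* If [b] does not serve [m], the induction hypothesis at [m] gives [C * q ^+ n], already above the
   target. *)
have [[c cB /(drop _ _ cB)[/andP[lb ub] _]]|b0] := nearest m.
  apply: ltP; apply: lt_le_trans (le_trans lb ub); rewrite lte_fin ltr_pM2l//.
  by rewrite qS gtr_pMl ?exprn_gt0//; lra.
have shift k : (m + k)%:R - b = m%:R - b + k%:R by rewrite natrD; ring.
(* Here [b] serves [m] but not [m.+1]: the only case where equality can occur. *)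
have [[c cB /(drop _ _ cB)[/andP[lb ub] meansE]]|b1] := nearest m.+1.
  have CE : C * q ^+ n.+1 = 0 + q * (C * q ^+ n) by rewrite qS; ring.
  split.
    apply: le_trans (step _ _ _ b0 (le_trans lb ub)).
    by rewrite lee_fin CE lerD2r sqr_ge0.
  rewrite geo_error_recl// b0 => eqC.
  have gfin : geo_error q m.+1 B \is a fin_num.
    have : (0 <= geo_error q m.+1 B)%E.
      apply: le_trans (le_trans lb ub); rewrite lee_fin mulr_ge0 ?ltW//.
      by rewrite exprn_gt0.
    move: eqC; case: (geo_error q m.+1 B) => //=.
    by rewrite gt0_muley ?lte_fin.
  rewrite -(fineK gfin) in ub eqC.
  have lb1 : C * q ^+ n <= fine (geo_error q m.+1 B).
    by rewrite -lee_fin (le_trans lb ub).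
  move: eqC; rewrite -EFinM -EFinD => -[eqC].
  have u0 : 0 <= (m%:R - b) ^+ 2 by exact: sqr_ge0.
  (* The error exceeds the bound by [(m%:R - b) ^+ 2] plus [q] times the excess from [m.+1] on; both
     are nonnegative, so equality forces both to vanish. *)
  have bm : (m%:R - b) ^+ 2 = 0.
    by apply/le_anti; rewrite u0 andbT; nra.
  have gE : fine (geo_error q m.+1 B) = C * q ^+ n.
    apply: (mulfI (lt0r_neq0 q0)); rewrite -[LHS]add0r -bm eqC CE; ring.
  have bE : m%:R = b by apply/eqP; rewrite -subr_eq0 -sqrf_eq0 bm.
  rewrite geo_meansS bE -meansE ?fsetD1K//.
  (* The error of [B] without [b] is squeezed between the bound and the error of [B], so the
     uniqueness part of the induction hypothesis applies. *)
  by apply/le_anti; rewrite lb andbT -gE.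
have [[c cB /(drop _ _ cB)[/andP[lb ub] _]]|b2] := nearest m.+2.
  apply: ltP; apply: lt_le_trans (step _ _ _ b0 (step _ _ _ b1 (le_trans lb ub))).
  by rewrite lte_fin qS -[m.+1]addn1 shift; exact: two_point_bound.
(* [b] serves [m], [m.+1] and [m.+2]: these three terms already exceed the target, and the tail is
   bounded below by 0. *)
have G0 : (0%:E <= geo_error q m.+3 B)%E.
  apply: nneseries_ge0 => j _ _.
  by rewrite mule_ge0 ?sqdist_ge0// lee_fin exprn_ge0.
apply: ltP; apply: lt_le_trans (step _ _ _ b0 (step _ _ _ b1 (step _ _ _ b2 G0))).
rewrite lte_fin qS mulr0 addr0 -[m.+2]addn2 -[m.+1]addn1 !shift; exact: three_point_bound.
Qed.

(** * Transfer to the law [P] *)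

(** The prescribed atoms have total mass 1, so the complement of the positive integers is negligible
    and the integral splits over the atoms. *)
Lemma distortion_geometric (R : realType) (x : R)
    (P : probability (measurableTypeR R) R) (B : {fset R}) :
    2^-1 < x < 1 ->
    (forall j : nat, P [set j.+1%:R]%classic = ((1 - x) ^+ j * x)%:E) ->
  distortion P B = (x%:E * geo_error (1 - x) 1 B)%E.
Proof.
move=> /andP[x2 x1] PE; have q0 : 0 <= 1 - x by lra.
have q2 : 1 - x < 2^-1 by lra.
pose F (j : nat) : set (measurableTypeR R) := [set j.+1%:R]%classic.
have mF j : measurable (F j) by exact: measurable_set1.
have tF : trivIset setT F.
  by move=> i j _ _ [y [/= -> /eqP]]; rewrite eqr_nat => /eqP[].
pose D := (\bigcup_j F j)%classic.
have mD : measurable D by exact: bigcup_measurable.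
have PD : P D = 1%E.
  rewrite measure_semi_bigcup//.
  rewrite (eq_eseriesr (g := fun j => ((1 - x) ^+ j * x)%:E)) => [|j _]; last first.
    exact: PE.
  rewrite (@telescoping_geometric_series _ _ 1 (fun=> 1))//.
  - by move=> _; rewrite (le_trans _ (ltW x2)).
  - by move=> _; rewrite mulr1 subKr.
  - by move=> j; rewrite normr1 mul1r exprn_ege1// ler1n.
rewrite /distortion (@ge0_negligible_integral _ _ _ P setT (~` D)%classic)//.
- rewrite setTD setCK ge0_integral_bigcup//.
  + rewrite /geo_error -nneseriesZl => [|j _]; last first.
      by rewrite mule_ge0 ?sqdist_ge0// lee_fin exprn_ge0.
    apply: eq_eseriesr => j _.
    rewrite (eq_integral (cst (sqdist B j.+1%:R))) => [|y]; last first.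
      by rewrite inE => ->.
    transitivity (sqdist B j.+1%:R * ((1 - x) ^+ j * x)%:E)%E.
      by rewrite -PE; exact: integral_cst.
    by rewrite add1n muleC muleA -EFinM mulrC.
  + by apply: measurable_funS (measurable_sqdist B).
  + by move=> y _; exact: sqdist_ge0.
- exact: measurableC.
- exact: measurable_sqdist.
- by move=> y _; exact: sqdist_ge0.
- by apply: (etrans (probability_setC P mD)); rewrite PD subee.
Qed.

(** Memorylessness: given that it is at least [n.+1], the variable is [n.+1] plus a geometric excess
    of mean [(1 - x) / x]. *)
Lemma Av_geometric (R : realType) (x : R)
    (P : probability (measurableTypeR R) R) (n : nat) :
    2^-1 < x < 1 ->
    (forall j : nat, P [set j.+1%:R]%classic = ((1 - x) ^+ j * x)%:E) ->
  Av P n.+1 = n.+1%:R + (1 - x) / x.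
Proof.
move=> /andP[x2 x1] PE; have x0 : 0 < x by lra.
have q0 : 0 < 1 - x by lra.
have mu0 : 0 <= (1 - x) / x by rewrite divr_ge0 ?ltW.
have mass_ge0 j : (0 <= mass P j)%E by exact: measure_ge0.
have massE i : mass P (i + n.+1) = ((1 - x) ^+ i * ((1 - x) ^+ n * x))%:E.
  by rewrite addnS /mass PE exprD mulrA.
rewrite /Av -(@nneseries_addn _ (fun j => (j%:R)%:E * mass P j)%E) => [|i]; last first.
  by rewrite mule_ge0// lee_fin ler0n.
rewrite -(@nneseries_addn _ (mass P))//.
rewrite (eq_eseriesr (g := fun i => ((1 - x) ^+ i *
    ((1 - x) ^+ n * x * (i + n.+1)%:R))%:E)) => [|i _]; last first.
  by rewrite massE -EFinM; congr EFin; ring.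
rewrite [X in _ / fine X](eq_eseriesr (g := fun i => ((1 - x) ^+ i *
    ((1 - x) ^+ n * x))%:E)); last by move=> i _; rewrite massE.
pose e : R := n.+1%:R + (1 - x) / x.
have e0 : 0 <= e by rewrite addr_ge0.
rewrite (@telescoping_geometric_series _ _ ((1 - x) ^+ n * (e ^+ 2 + 2))
    (fun i => (1 - x) ^+ n * (e + i%:R))); first last.
- move=> j; rewrite ger0_norm ?mulr_ge0 ?exprn_ge0 ?(ltW q0) ?(addr_ge0 e0)//.
  rewrite -mulrA ler_pM2l ?exprn_gt0//.
  apply: le_trans (sqr_le_exp2 e j); move: (e + _) => d.
  by have := sqr_ge0 (d - 1); have := sqr_ge0 d; lra.
- by move=> j; rewrite /e natrD -[j.+1%:R]natr1; field; lra.
- by move=> j; rewrite !mulr_ge0 ?exprn_ge0//; exact: ltW.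
- lra.
- lra.
rewrite (@telescoping_geometric_series _ _ ((1 - x) ^+ n)
    (fun i => (1 - x) ^+ n)); first last.
- move=> j; rewrite ger0_norm ?exprn_ge0 ?(ltW q0)//.
  by rewrite ler_peMr ?exprn_ge0 ?(ltW q0)// exprn_ege1// ler1n.
- by move=> j; ring.
- by move=> j; rewrite !mulr_ge0 ?exprn_ge0//; exact: ltW.
- lra.
- lra.
rewrite /= addr0 mulrAC divff ?mul1r// expf_neq0// lt0r_neq0//.
Qed.

Theorem mainTheorem3 (R : realType) (x : R)
    (P : probability (measurableTypeR R) R)
    (* the left bound is 6666666667 / 10^10 = 0.6666666667 *)
    (hx : (6 * 10 ^+ 9 + 666 * 10 ^+ 6 + 666 * 10 ^+ 3 + 667) / 10 ^+ 10 <= x < 1)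
    (hP : forall j : nat, (1 <= j)%N ->
       P [set (j%:R : R)]%classic = ((1 - x) ^+ (j - 1) * x)%:E)
    (n : nat) (hn : (1 <= n)%N) :
  optimal_set P n (means_set P n) /\
  (forall alpha : {fset R}, optimal_set P n alpha -> alpha = means_set P n).
Proof.
have x1 : x < 1 by case/andP: hx.
(* The decimal bound lies strictly above 2/3, which gives [1 - x < 3^-1]. *)
have x23 : 2 / 3 < x by case/andP: hx => + _; apply: lt_le_trans; lra.
have x2 : 2^-1 < x < 1 by rewrite x1 andbT; lra.
have q3 : 0 < 1 - x < 3^-1 by lra.
have PE j : P [set j.+1%:R]%classic = ((1 - x) ^+ j * x)%:E.
  by rewrite hP// subn1.
case: n hn => // n _.
(* With [n.+1] means, [n] is the number of integer points, and [1 - (1 - x) = x] identifies the two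
   last points. *)
have -> : means_set P n.+1 = geo_means (1 - x) 1 n.
  by rewrite /means_set /geo_means (Av_geometric _ x2 PE) add1n subKr.
set M := geo_means _ _ _.
pose V := (1 - x) / (1 - (1 - x)) ^+ 3 * (1 - x) ^+ n.
have GM : geo_error (1 - x) 1 M = V%:E.
  apply/le_anti; rewrite geo_error_means_le//=.
  by have [] := geo_error_lower_bound 1 q3 (card_geo_means (1 - x) 1 n).
have infE : ereal_inf [set distortion P beta
    | beta in [set beta : {fset R} | (1 <= #|` beta| <= n.+1)%N]]%classic =
    (x%:E * V%:E)%E.
  apply/le_anti/andP; split.
    apply: ereal_inf_lbound; exists M; first exact: card_geo_means.
    by rewrite (distortion_geometric _ x2 PE) GM.
  apply: le_ereal_inf_tmp => _ [B cardB <-]; rewrite (distortion_geometric _ x2 PE).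
  apply: lee_wpmul2l; first by rewrite lee_fin; lra.
  by have [] := geo_error_lower_bound 1 q3 cardB.
split=> [|B []]; rewrite /optimal_set infE.
  by rewrite (distortion_geometric _ x2 PE) GM card_geo_means.
move=> cardB; rewrite (distortion_geometric _ x2 PE) => xE.
have [_ BM] := geo_error_lower_bound 1 q3 cardB; apply: BM.
have x0 : (0 < x%:E)%E by rewrite lte_fin; lra.
by apply/le_anti/andP; split; rewrite -(lee_pmul2l _ x0)// xE.
Qed.
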